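(* Christofides' algorithm is a $3N$-approximation algorithm for the Minimal Cycle Time problem when the connectivity graph $\mathcal G_c$ (with $N$ nodes) is edge-capacitated and Euclidean. That is, if $\hat C$ is the directed ring obtained from the Hamiltonian cycle that Christofides' algorithm returns on the complete graph on $\mathcal V$ with edge weights $d_c$, then $\tau(\hat C)\le 3N\,\tau^*$, where $\tau^*$ is the minimum cycle time over all strongly connected spanning subdigraphs of $\mathcal G_c$.
   Context: Setting. $\mathcal G_c=(\mathcal V,\mathcal E_c)$ is a digraph without self-loops on $N$ nodes. The data are an integer $s\ge 1$, a model size $M$, computation times $T_c(i)\ge 0$, and for each arc $(i,j)$ a latency $l(i,j)\ge 0$ and an available bandwidth $A(i',j')>0$ (a number attached to the ordered pair $(i,j)$). In an edge-capacitated network the delay of a link is $d_o(i,j)=d_c(i,j):=s\,T_c(i)+l(i,j)+M/A(i',j')$, independent of the overlay. Euclidean. $\mathcal G_c$ is Euclidean if it is complete, $d_c(i,j)=d_c(j,i)$ for all $i,j$, and $d_c(i,j)\le d_c(i,k)+d_c(k,j)$ for all $i,j,k$. Cycle time. For a strongly connected spanning subdigraph $\mathcal G_o$ of $\mathcal G_c$, a circuit is a closed path $\gamma=(i_1,\dots,i_p=i_1)$, $p>1$, along arcs of $\mathcal G_o$; $|\gamma|$ is its number of arcs and $d_c(\gamma)=\sum_{k=1}^{p-1}d_c(i_k,i_{k+1})$. The cycle time is $\tau(\mathcal G_o)=\max_\gamma d_c(\gamma)/|\gamma|$ over all circuits $\gamma$ of $\mathcal G_o$. In particular a directed ring has cycle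 time equal to its total delay divided by $N$. Minimal Cycle Time problem (MCT): find a strongly connected spanning subdigraph of $\mathcal G_c$ with minimal cycle time. Christofides' algorithm is the classical polynomial-time algorithm for the metric Travelling Salesman Problem (minimum spanning tree, plus minimum-weight perfect matching on its odd-degree vertices, Eulerian circuit, shortcutting to a Hamiltonian cycle); it is known to return a Hamiltonian cycle of weight at most $\tfrac32$ times that of a minimum-weight Hamiltonian cycle. The returned cycle is used as a directed ring, traversed in one (arbitrary) direction. *)

(* Defs.v *)
From mathcomp Require Import all_boot all_order all_algebra.

Set Implicit Arguments.
Unset Strict Implicit.
Unset Printing Implicit Defensive.

Import Order.TTheory GRing.Theory Num.Theory.
Local Open Scope ring_scope.

(* A closed path (i_1, ..., i_p = i_1) is encoded by the sequence
   c = [:: i_1; ...; i_(p-1)], the closing vertex being left implicit, as for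
   [path.cycle]. Its length |gamma| = p - 1 is then [size c]. *)
Definition closed_arcs (V : finType) (c : seq V) : seq (V * V) :=
  zip c (rot 1 c).

Section Network.
Variables (R : realFieldType) (V : finType).

Definition link_delay (s : nat) (M : R) (Tc : V -> R) (l A : V -> V -> R)
    (i j : V) : R :=
  s%:R * Tc i + l i j + M / A i j.

(* Delays are attached to arcs, so symmetry and the triangle inequality are
   required on arcs only; the values [d i i] are meaningless. *)
Definition euclidean (Ec : rel V) (d : V -> V -> R) : Prop :=
  [/\ forall i j, i != j -> Ec i j,
      forall i j, Ec i j -> d i j = d j i
    & forall i j k, Ec i j -> Ec i k -> Ec k j -> d i j <= d i k + d k j].

Definition circuit (E : rel V) (c : seq V) : bool := (c != [::]) && cycle E c.

Definition circuit_delay (d : V -> V -> R) (c : seq V) : R :=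
  \sum_(a <- closed_arcs c) d a.1 a.2.

Definition circuit_mean (d : V -> V -> R) (c : seq V) : R :=
  circuit_delay d c / (size c)%:R.

(* Circuits may repeat vertices, so there are infinitely many of them: the
   cycle time is a maximum in the sense of an attained upper bound. *)
Definition is_cycle_time (d : V -> V -> R) (E : rel V) (t : R) : Prop :=
  (exists2 c, circuit E c & circuit_mean d c = t)
  /\ (forall c, circuit E c -> circuit_mean d c <= t).

Definition overlay (Ec E : rel V) : Prop :=
  subrel E Ec /\ (forall i j, connect E i j).

Definition is_min_cycle_time (d : V -> V -> R) (Ec : rel V) (t : R) : Prop :=
  (exists2 E, overlay Ec E & is_cycle_time d E t)
  /\ (forall E t', overlay Ec E -> is_cycle_time d E t' -> t <= t').

Definition directed_ring (h : seq V) : rel V :=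
  [rel i j | (i, j) \in closed_arcs h].

End Network.

(* Undirected simple graphs on V are sets of two-element subsets of V. *)
Section Christofides.
Variables (R : realFieldType) (V : finType) (d : V -> V -> R).

(* The orientation in which the two endpoints are enumerated is irrelevant
   when d is symmetric, see [edge_weightE]. *)
Definition edge_weight (e : {set V}) : R :=
  if enum e is [:: i; j] then d i j else 0.

Lemma edge_weightE (i j : V) :
  i != j -> d i j = d j i -> edge_weight [set i; j] = d i j.
Proof.
move=> neq_ij dC; rewrite /edge_weight.
have enum_ij : perm_eq (enum [set i; j]) [:: i; j].
  apply: uniq_perm; rewrite ?enum_uniq /= ?inE ?neq_ij // => x.
  by rewrite mem_enum !inE.
move: (perm_size enum_ij) (perm_mem enum_ij) (perm_uniq enum_ij).
case: (enum _) => [|x [|y [|z t]]] //= _ mem_xy; rewrite !inE neq_ij /= andbT.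
have := mem_xy x; have := mem_xy y; rewrite !inE !eqxx orbT /=.
by move=> /esym/orP[]/eqP-> /esym/orP[]/eqP->; rewrite ?eqxx.
Qed.

Definition weight (F : {set {set V}}) : R := \sum_(e in F) edge_weight e.

Definition simple_graph (F : {set {set V}}) : Prop :=
  forall e, e \in F -> #|e| = 2.

Definition adj (F : {set {set V}}) : rel V := [rel i j | [set i; j] \in F].

Definition spanning_tree (T : {set {set V}}) : Prop :=
  [/\ simple_graph T,
      forall i j, connect (adj T) i j
    & forall c, uniq c -> (2 < size c)%N -> ~~ cycle (adj T) c].

Definition min_spanning_tree (T : {set {set V}}) : Prop :=
  spanning_tree T /\ (forall T', spanning_tree T' -> weight T <= weight T').

Definition odd_vertices (F : {set {set V}}) : {set V} :=
  [set v | odd #|[set e in F | v \in e]|].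

(* A perfect matching of the complete graph on O is a partition of O into
   pairs. *)
Definition perfect_matching (O : {set V}) (F : {set {set V}}) : Prop :=
  simple_graph F /\ partition F O.

Definition min_perfect_matching (O : {set V}) (F : {set {set V}}) : Prop :=
  perfect_matching O F
  /\ (forall F', perfect_matching O F' -> weight F <= weight F').

(* Edges of the multigraph with edge list H are used exactly as many times as
   they occur in H. *)
Definition eulerian_circuit (H : seq {set V}) (c : seq V) : Prop :=
  perm_eq [seq [set a.1; a.2] | a <- closed_arcs c] H.

Definition hamiltonian_cycle (h : seq V) : Prop :=
  uniq h /\ (forall v, v \in h).

(* [christofides h]: h is a possible output of the algorithm, whichever
   minimum spanning tree, minimum-weight matching, Eulerian circuit and
   shortcuts are chosen. An edge of both T and F is doubled in the multigraph,
   and shortcutting skips repeated vertices of the Eulerian circuit. *)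
Definition christofides (h : seq V) : Prop :=
  exists (T F : {set {set V}}) (c : seq V),
    [/\ min_spanning_tree T,
        min_perfect_matching (odd_vertices T) F,
        eulerian_circuit (enum T ++ enum F) c,
        subseq h c
      & hamiltonian_cycle h].

End Christofides.

(* Main.v *)
(** All Hamiltonian rings are good enough: if G is strongly connected with cycle
    time t, then for distinct i and j simple paths of G from i to j and back
    form a circuit with at most 2N arcs, hence of delay at most 2Nt. By the
    triangle inequality and symmetry this delay is at least 2 d(i,j), so every
    delay is at most Nt, and so is the mean delay of any circuit of any overlay.
    The cycle time is attained because a circuit that repeats a vertex splits
    into two shorter ones, which reduces the maximum to the finitely many
    circuits without repetition. *)
Require Import Defs.
From mathcomp Require Import all_boot all_order all_algebra.
From mathcomp Require Import lra.
Import Order.TTheory GRing.Theory Num.Theory.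
Local Open Scope ring_scope.

(** * Arcs of closed paths, and splitting at a repeated vertex *)

Lemma closed_arcs_cons (V : finType) (x : V) (p : seq V) :
  closed_arcs (x :: p) = zip (x :: p) (rcons p x).
Proof. by rewrite /closed_arcs rot1_cons. Qed.

Lemma size_closed_arcs (V : finType) (c : seq V) :
  size (closed_arcs c) = size c.
Proof. by rewrite size_zip size_rot minnn. Qed.

(** Cuts a closed path into a walk from [x] to [y] and a walk back. Up to order the two walks can be
    exchanged, which rotates the path; for [y = x] each of them is closed. *)
Lemma closed_arcs_cat (V : finType) (x y : V) (p q : seq V) :
  closed_arcs (x :: p ++ y :: q) =
  zip (x :: p) (rcons p y) ++ zip (y :: q) (rcons q x).
Proof.
rewrite closed_arcs_cons rcons_cat rcons_cons -[p ++ y :: rcons q x]cat_rcons.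
by rewrite -[x :: p ++ _]cat_cons zip_cat ?size_rcons.
Qed.

Lemma path_all_arcs (V : finType) (E : rel V) (x : V) (p : seq V) :
  path E x p = all (fun a => E a.1 a.2) (zip (belast x p) p).
Proof. by elim: p x => //= y p IHp x; rewrite IHp. Qed.

(** Makes being a cycle depend on the arcs only, so that it passes through permutations and
    concatenations of arc lists. *)
Lemma cycle_all_arcs (V : finType) (E : rel V) (c : seq V) :
  cycle E c = all (fun a => E a.1 a.2) (closed_arcs c).
Proof.
case: c => // x p.
by rewrite closed_arcs_cons [cycle _ _]path_all_arcs belast_rcons.
Qed.

Lemma uniq_cycle_neq (V : finType) (c : seq V) :
  uniq c -> (1 < size c)%N -> cycle [rel i j | i != j] c.
Proof.
case: c => // x p uniq_xp p_gt0 /=; rewrite rcons_path /=; apply/andP; split.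
  have := uniq_xp; rewrite uniq_pairwise => /pairwise_sorted; exact.
case/lastP: p => // p y in uniq_xp p_gt0 *.
rewrite last_rcons; apply: contraTneq uniq_xp => ->.
by rewrite /= mem_rcons mem_head.
Qed.

Lemma nuniq_split (T : eqType) (c : seq T) :
  ~~ uniq c -> exists p x q r, c = p ++ x :: q ++ x :: r.
Proof.
elim: c => //= x c IHc; rewrite negb_and negbK => /orP[/splitPr[q r]|].
  by exists [::], x, q, r.
by move=> /IHc[p [y [q [r ->]]]]; exists (x :: p), y, q, r.
Qed.

(** Between its two occurrences [x] closes the loop [x :: q]; what remains, read cyclically from the
    second occurrence, is the loop [x :: r ++ p]. *)
Lemma closed_arcs_split (V : finType) (c : seq V) : ~~ uniq c ->
  exists c1 c2, [/\ c1 != [::], c2 != [::]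
    & perm_eq (closed_arcs c) (closed_arcs c1 ++ closed_arcs c2)].
Proof.
move=> /nuniq_split[p [x [q [r ->]]]]; exists (x :: q), (x :: r ++ p).
split=> //; rewrite !closed_arcs_cons -closed_arcs_cat.
case: p => [|y p]; first by rewrite cats0.
have -> : x :: q ++ x :: r ++ y :: p = x :: (q ++ x :: r) ++ y :: p.
  by rewrite -catA.
by rewrite cat_cons !closed_arcs_cat perm_catC.
Qed.

(** * The cycle time as an attained maximum *)

Section CycleTime.
Variables (R : realFieldType) (V : finType) (d : V -> V -> R).

Lemma circuit_mean_leE (E : rel V) (c : seq V) (t : R) : circuit E c ->
  (circuit_mean d c <= t) = (circuit_delay d c <= t * (size c)%:R).
Proof.
by case/andP=> c_neq0 _; rewrite ler_pdivrMr // ltr0n lt0n size_eq0.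
Qed.

Lemma circuit_mean_le_arcs (E : rel V) (c : seq V) (t : R) :
  (forall i j, E i j -> d i j <= t) -> circuit E c -> circuit_mean d c <= t.
Proof.
move=> le_dt circ_c; rewrite (circuit_mean_leE _ _ _ circ_c).
have /andP[_] := circ_c; rewrite cycle_all_arcs => /allP E_c.
have -> : t * (size c)%:R = \sum_(a <- closed_arcs c) t.
  by rewrite big_const_seq count_predT size_closed_arcs iter_addr_0 mulr_natr.
by rewrite /circuit_delay !big_seq; apply: ler_sum => a /E_c; apply: le_dt.
Qed.

(** Strong induction on the length: the mean of a circuit that splits is the average of the means of
    its two pieces, weighted by their lengths. *)
Lemma circuit_mean_le_uniq (E : rel V) (t : R) :
  (forall c, circuit E c -> uniq c -> circuit_mean d c <= t) ->
  forall c, circuit E c -> circuit_mean d c <= t.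
Proof.
move=> le_t c; have [n] := ubnP (size c); elim: n c => // n IHn c.
rewrite ltnS => le_cn circ_c.
have [/(le_t _ circ_c) //|] := boolP (uniq c).
move=> /closed_arcs_split[c1 [c2 [c1_neq0 c2_neq0 perm_c]]].
have size_c : size c = (size c1 + size c2)%N.
  by rewrite -size_closed_arcs (perm_size perm_c) size_cat !size_closed_arcs.
have c1_gt0 : (0 < size c1)%N by rewrite lt0n size_eq0.
have c2_gt0 : (0 < size c2)%N by rewrite lt0n size_eq0.
have [circ1 circ2] : circuit E c1 /\ circuit E c2.
  have /andP[_] := circ_c; rewrite /circuit c1_neq0 c2_neq0 !cycle_all_arcs.
  by rewrite (perm_all _ perm_c) all_cat => /andP.
have mean_c1 : circuit_mean d c1 <= t.
  by apply: IHn => //; apply: leq_trans le_cn; rewrite size_c -ltn_subLR ?subnn.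
have mean_c2 : circuit_mean d c2 <= t.
  apply: IHn => //; apply: leq_trans le_cn.
  by rewrite size_c addnC -ltn_subLR ?subnn.
rewrite (circuit_mean_leE _ _ _ circ1) in mean_c1.
rewrite (circuit_mean_leE _ _ _ circ2) in mean_c2.
rewrite (circuit_mean_leE _ _ _ circ_c) size_c natrD mulrDr.
by rewrite /circuit_delay (perm_big _ perm_c) big_cat lerD.
Qed.

Lemma exists_cycle_time (E : rel V) (c : seq V) :
  circuit E c -> exists t, is_cycle_time d E t.
Proof.
move=> circ_c.
(* A sequence without repetition has length at most [#|V|], so the finite type [I] contains all of
   them. *)
pose I := {k : 'I_#|V|.+1 & k.-tuple V}.
pose seq_of (u : I) : seq V := tagged u.
have uniq_seq_of e : uniq e -> exists u, seq_of u = e.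
  move=> uniq_e; have size_e : (size e < #|V|.+1)%N.
    by rewrite ltnS -(card_uniqP uniq_e) max_card.
  by exists (Tagged (fun k : 'I_#|V|.+1 => k.-tuple V)
               (in_tuple e : (Ordinal size_e).-tuple V)).
pose P := [pred u | circuit E (seq_of u) && uniq (seq_of u)].
have [u0 Pu0] : exists u0, P u0.
  case: (pickP P) => [u0 Pu0|P0]; first by exists u0.
  (* Without repetition-free circuits, every real number would vacuously bound all means, even one
     below the mean of [c]. *)
  suff: circuit_mean d c <= circuit_mean d c - 1 by lra.
  apply: (circuit_mean_le_uniq E) circ_c => e circ_e uniq_e.
  by have [u def_e] := uniq_seq_of e uniq_e; have := P0 u;
    rewrite /= def_e circ_e uniq_e.
case: (arg_maxP (fun u => circuit_mean d (seq_of u)) Pu0).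
move=> u /andP[circ_u _] max_u.
exists (circuit_mean d (seq_of u)); split; first by exists (seq_of u).
apply: circuit_mean_le_uniq => e circ_e uniq_e.
have [v def_e] := uniq_seq_of e uniq_e; rewrite -def_e.
by apply: max_u; rewrite /= def_e circ_e.
Qed.

(** * Delays of walks and the triangle inequality *)

Definition walk_delay (x : V) (p : seq V) : R :=
  \sum_(a <- zip (belast x p) p) d a.1 a.2.

Lemma walk_delay_cons (x y : V) (p : seq V) :
  walk_delay x (y :: p) = d x y + walk_delay y p.
Proof. by rewrite /walk_delay /= big_cons. Qed.

Lemma walk_circuit (E : rel V) (x : V) (p q : seq V) :
    path E x p -> path E (last x p) q -> last (last x p) q = x -> p != [::] ->
  exists c, [/\ circuit E c, size c = (size p + size q)%N
    & circuit_delay d c = walk_delay x p + walk_delay (last x p) q].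
Proof.
(* [belast] drops the final return to [x], since the closing vertex of a circuit is implicit. *)
move=> Ep Eq q_x p_neq0; exists (belast x (p ++ q)).
have arcsE : closed_arcs (belast x (p ++ q)) = zip (belast x (p ++ q)) (p ++ q).
  have pq_x : last x (p ++ q) = x by rewrite last_cat.
  have : p ++ q != [::] by case: (p) p_neq0.
  case/lastP: (p ++ q) pq_x => // r z; rewrite last_rcons => -> _.
  by rewrite belast_rcons closed_arcs_cons.
split; last 2 first.
- by rewrite size_belast size_cat.
- by rewrite /circuit_delay arcsE belast_cat zip_cat ?size_belast // big_cat.
rewrite /circuit cycle_all_arcs arcsE -path_all_arcs cat_path Ep Eq !andbT.
by rewrite -size_eq0 size_belast size_cat; case: (p) p_neq0.
Qed.

Section Euclidean.
Variable Ec : rel V.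
Hypotheses (Ec_irr : irreflexive Ec) (d_euclid : euclidean Ec d).
Hypothesis d_ge0 : forall i j, Ec i j -> 0 <= d i j.

(** Iterated triangle inequality. It is available on arcs only, and simplicity of the path ensures
    that the pairs compared are distinct, hence arcs. *)
Lemma le_walk_delay (x : V) (p : seq V) :
  path Ec x p -> uniq (x :: p) -> p != [::] -> d x (last x p) <= walk_delay x p.
Proof.
have [Ec_full _ d_tri] := d_euclid.
elim: p x => // y p IHp x; rewrite walk_delay_cons => /andP[Exy Ep].
case: p => [|z p] in IHp Ep *; first by rewrite /walk_delay big_nil addr0.
set q := z :: p in IHp Ep *; rewrite [uniq _]/= => /andP[xNyq uniq_yq] _.
have last_q : last y q \in q by rewrite /q /= mem_last.
have xNlast : x != last y q.
  by apply: contraNneq xNyq => ->; rewrite inE last_q orbT.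
have yNlast : y != last y q.
  by case/andP: uniq_yq => yNq _; apply: contraNneq yNq => ->.
apply: le_trans (lerD (lexx _) (IHp y Ep uniq_yq isT)).
by apply: d_tri => //; apply: Ec_full.
Qed.

Lemma overlay_circuit (E : rel V) (i j : V) : overlay Ec E -> i != j ->
  exists c, [/\ circuit E c, (size c <= 2 * #|V|)%N
    & 2 * d i j <= circuit_delay d c].
Proof.
move=> [subE connE] neq_ij; have [Ec_full d_sym _] := d_euclid.
have [p Ep jE] := connectP (connE i j); have [q Eq iE] := connectP (connE j i).
(* Shortening to simple paths bounds the number of arcs and makes [le_walk_delay] applicable. *)
case: (shortenP Ep) jE => {}p {}Ep uniq_p _ jE.
case: (shortenP Eq) iE => {}q {}Eq uniq_q _ iE.
have p_neq0 : p != [::].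
  by apply: contraNneq neq_ij => p0; rewrite jE p0.
have q_neq0 : q != [::].
  by apply: contraNneq neq_ij => q0; rewrite iE q0.
have [c [circ_c size_c delay_c]] : exists c, [/\ circuit E c,
    size c = (size p + size q)%N
    & circuit_delay d c = walk_delay i p + walk_delay j q].
  by rewrite jE; apply: walk_circuit; rewrite -?jE.
exists c; split=> //.
  have card_le (x : V) r : uniq (x :: r) -> (size r <= #|V|)%N.
    move=> uniq_xr; rewrite ltnW //.
    by rewrite -[X in (X <= _)%N](card_uniqP uniq_xr) max_card.
  by rewrite size_c mul2n -addnn leq_add ?(card_le _ _ uniq_p)
    ?(card_le _ _ uniq_q).
have Ecp : path Ec i p by apply: sub_path Ep.
have Ecq : path Ec j q by apply: sub_path Eq.
have := le_walk_delay _ _ Ecp uniq_p p_neq0.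
have := le_walk_delay _ _ Ecq uniq_q q_neq0.
rewrite -jE -iE -(d_sym i j) ?Ec_full // delay_c; lra.
Qed.

Lemma delay_le_cycle_time (E : rel V) (t : R) (i j : V) :
  overlay Ec E -> is_cycle_time d E t -> Ec i j -> d i j <= #|V|%:R * t.
Proof.
move=> ovE [_ le_t] Eij.
have neq_ij : i != j by apply: contraTneq Eij => ->; rewrite Ec_irr.
have [c [circ_c size_c le_dij]] := overlay_circuit _ _ _ ovE neq_ij.
have := le_t c circ_c; rewrite (circuit_mean_leE _ _ _ circ_c) => le_ct.
have dij_ge0 := d_ge0 _ _ Eij.
have size_gt0 : 0 < (size c)%:R :> R.
  by case/andP: circ_c; rewrite ltr0n lt0n size_eq0.
(* The sign of [t] matters when the length of [c] is replaced by its upper bound [2 * #|V|]. *)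
have t_ge0 : 0 <= t.
  rewrite -(pmulr_lge0 _ size_gt0); apply: le_trans le_ct.
  by apply: le_trans le_dij; apply: mulr_ge0.
have : t * (size c)%:R <= t * (2 * #|V|%:R).
  by rewrite ler_wpM2l // -natrM ler_nat.
lra.
Qed.

(** * Existence of the minimum cycle time *)

Lemma exists_min_cycle_time (E0 : rel V) :
    (2 <= #|V|)%N -> overlay Ec E0 ->
  exists t, is_min_cycle_time d Ec t.
Proof.
case/card_gt1P=> x [y [_ _ neq_xy]] ovE0.
(* Two distinct vertices guarantee a circuit in every overlay, so the maximum is not over an empty
   family. *)
have has_ct E : overlay Ec E -> exists t, is_cycle_time d E t.
  by case/overlay_circuit/(_ neq_xy) => c [circ_c _ _];
    apply: exists_cycle_time circ_c.
(* Sets of arcs form a finite type, over which a minimum can be chosen; coding a relation preserves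
   it up to [=2]. *)
pose rel_of (S : {set V * V}) : rel V := [rel i j | (i, j) \in S].
pose set_of (E : rel V) := [set a | E a.1 a.2].
have rel_ofK E : rel_of (set_of E) =2 E by move=> i j; rewrite /rel_of /= inE.
have overlay_rel_of E : overlay Ec E -> overlay Ec (rel_of (set_of E)).
  move=> [subE connE]; split=> i j; first by rewrite rel_ofK; apply: subE.
  by rewrite (eq_connect (rel_ofK E)).
have circuit_rel_of E : circuit (rel_of (set_of E)) =1 circuit E.
  by move=> c; rewrite /circuit (eq_cycle (rel_ofK E)).
pose P S := [forall i, forall j, rel_of S i j ==> Ec i j]
  && [forall i, forall j, connect (rel_of S) i j].
have PP S : reflect (overlay Ec (rel_of S)) (P S).
  apply: (iffP andP) => [[/'forall_'forall_implyP subS /'forall_forallP connS]|].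
    by split.
  move=> [subS connS]; split; first exact/'forall_'forall_implyP.
  exact/'forall_forallP.
(* Finite choice of a cycle time for each code, with the dummy value 0 when the code is not an
   overlay. *)
have [ct ctP] : exists ct, forall S, P S -> is_cycle_time d (rel_of S) (ct S).
  apply: (@fin_all_exists _ _ (fun S t => P S -> is_cycle_time d (rel_of S) t)).
  move=> S; have [/PP/has_ct[t ct_t]|_] := boolP (P S).
    by exists t.
  by exists 0.
have P0 : P (set_of E0) by apply/PP/overlay_rel_of.
case: (arg_minP ct P0) => S PS min_S; exists (ct S); split.
  by exists (rel_of S); [apply/PP | apply: ctP].
move=> E t' ovE [_ le_t'].
have PE : P (set_of E) by apply/PP/overlay_rel_of.
(* [E] and its code have the same circuits, so the circuit attaining the cycle time of the code has
   mean at most [t']. *)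
have [[c circ_c mean_c] _] := ctP _ PE.
by apply: le_trans (min_S _ PE) _; rewrite -mean_c le_t' // -circuit_rel_of.
Qed.
End Euclidean.
End CycleTime.

(** * Hamiltonian rings and the approximation bound *)

Lemma directed_ring_overlay (V : finType) (Ec : rel V) (c : seq V) :
    (forall i j, i != j -> Ec i j) -> (2 <= #|V|)%N -> hamiltonian_cycle c ->
  overlay Ec (directed_ring c).
Proof.
move=> Ec_full V_ge2 [uniq_c mem_c].
have size_c : (1 < size c)%N.
  rewrite -(card_uniqP uniq_c); apply: leq_trans V_ge2 _.
  by apply/subset_leq_card/subsetP => x _; apply: mem_c.
split=> i j.
  (* With at least two vertices the ring has no loop, so completeness makes all its pairs arcs of
     [Ec]. *)
  have := uniq_cycle_neq _ _ uniq_c size_c.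
  rewrite cycle_all_arcs => /allP arcs_c.
  by move=> /arcs_c; apply: Ec_full.
apply: (@connect_cycle _ _ c) => //.
by rewrite cycle_all_arcs; apply/allP => -[].
Qed.

Theorem proposition3p3 (R : realFieldType) (V : finType) (Ec : rel V)
    (s : nat) (M : R) (Tc : V -> R) (l A : V -> V -> R) (h c : seq V)
    (N_ge2 : (2 <= #|V|)%N)
    (Ec_irr : irreflexive Ec)
    (s_ge1 : (1 <= s)%N)
    (M_ge0 : 0 <= M)
    (Tc_ge0 : forall i, 0 <= Tc i)
    (l_ge0 : forall i j, Ec i j -> 0 <= l i j)
    (A_gt0 : forall i j, Ec i j -> 0 < A i j) :
  let d := link_delay s M Tc l A in
  euclidean Ec d ->
  christofides d h ->
  c = h \/ c = rev h ->
  overlay Ec (directed_ring c) /\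
  exists tau tau_star : R,
    [/\ is_cycle_time d (directed_ring c) tau,
        is_min_cycle_time d Ec tau_star
      & tau <= 3 * #|V|%:R * tau_star].
Proof.
move=> d d_euclid [T [F [e [_ _ _ _ [uniq_h mem_h]]]]] c_h.
have ham_c : hamiltonian_cycle c.
  by case: c_h => ->; split; rewrite ?rev_uniq // => v; rewrite mem_rev.
have [Ec_full _ _] := d_euclid.
have d_ge0 i j : Ec i j -> 0 <= d i j.
  move=> Eij; rewrite /d /link_delay !addr_ge0 ?mulr_ge0 ?ler0n ?l_ge0 //.
  by rewrite invr_ge0 ltW // A_gt0.
have ov_c := directed_ring_overlay _ _ _ Ec_full N_ge2 ham_c.
split=> //.
have [t_star min_t] := exists_min_cycle_time _ _ d _ d_euclid _ N_ge2 ov_c.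
have [[E ovE ctE] _] := min_t.
have /card_gt1P[x [y [_ _ neq_xy]]] := N_ge2.
have [e1 [circ_e1 _ _]] := overlay_circuit _ _ d _ d_euclid _ _ _ ov_c neq_xy.
have [tau ct_tau] := exists_cycle_time _ _ d _ _ circ_e1.
exists tau, t_star; split=> //.
have [[e2 circ_e2 <-] _] := ct_tau.
have le_Nt : circuit_mean d e2 <= #|V|%:R * t_star.
  apply: (circuit_mean_le_arcs _ _ d _ _ _ _ circ_e2) => i j /(ov_c.1 _ _).
  exact: (delay_le_cycle_time _ _ d Ec Ec_irr d_euclid d_ge0 _ _ _ _ ovE ctE).
(* The bound obtained is [#|V|%:R * t_star]; passing to three times it requires its sign, known
   because it dominates a delay. *)
have Nt_ge0 : 0 <= #|V|%:R * t_star.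
  apply: le_trans (d_ge0 _ _ (Ec_full _ _ neq_xy)) _.
  exact: (delay_le_cycle_time _ _ d Ec Ec_irr d_euclid d_ge0 _ _ _ _ ovE ctE
    (Ec_full _ _ neq_xy)).
lra.
Qed.
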